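(* Let $F$ be a scalar group, let $V$ be a near-vector space over $F$, and let $S\subseteq Q(V)$ be a generating set for $V$. Then there exists $B\subseteq S$ such that $B$ is a scalar basis for $V$.
   Context: A scalar group is a tuple $F=(F,\cdot,1,0,-1)$ where $(F,\cdot,1)$ is a monoid, $0,-1\in F$, $0\cdot\alpha=0=\alpha\cdot 0$ for all $\alpha\in F$, $\{1,-1\}$ is the solution set of the equation $x^2=1$ in $F$, and $(F\setminus\{0\},\cdot,1)$ is a group. An $F$-space is an abelian group $(V,+)$ with a map $F\times V\to V$, $(\alpha,v)\mapsto\alpha\cdot v$, such that for all $\alpha,\beta\in F$, $v,w\in V$: $\alpha\cdot(\beta\cdot v)=(\alpha\cdot\beta)\cdot v$, $1\cdot v=v$, $\alpha\cdot(v+w)=\alpha\cdot v+\alpha\cdot w$, $(-1)\cdot v=-v$, $0\cdot v=0$. The quasi-kernel of $V$ is $Q(V)=\{v\in V\mid \forall \alpha,\beta\in F\ \exists\gamma\in F:\ \alpha\cdot v+\beta\cdot v=\gamma\cdot v\}$. A near-vector space over $F$ is an $F$-space $V$ whose action is free (if $\alpha\cdot v=\beta\cdot v$ then $v=0$ or $\alpha=\beta$) and such that $Q(V)$ generates $V$ as an additive group. $\operatorname{Span}(S)$ is the intersection of all nonempty subsets of $V$ that contain $S$ and are closed under addition and scalar multiplication; $\operatorname{Span}(v)=\operatorname{Span}(\{v\})$. $S\subseteq V$ is a generating set for $V$ if $\operatorname{Span}(S)=V$. A subset $S\subseteq V$ is linearly independent if $0\notin S$ and for any nonempty finite $A\subseteq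 S$, $n_a\in\mathbb N$ and $\alpha_{a,i}\in F$ ($a\in A$, $1\le i\le n_a$), if $\sum_{a\in A}\left(\sum_{i=1}^{n_a}\alpha_{a,i}\cdot a\right)=0$ then $\sum_{i=1}^{n_a}\alpha_{a,i}\cdot a=0$ for all $a\in A$. An element $v\in V$ is scalar if $\operatorname{Span}(v)=F\cdot v:=\{\alpha\cdot v\mid\alpha\in F\}$. A basis of $V$ is a linearly independent generating set for $V$; a scalar basis is a basis all of whose elements are scalar. *)

(* Defs.v *)
From HB Require Import structures.
From mathcomp Require Import all_boot all_order all_algebra finmap.
From mathcomp Require Import boolp classical_sets.

Set Implicit Arguments.
Unset Strict Implicit.
Unset Printing Implicit Defensive.

Import GRing.Theory.

Local Open Scope classical_set_scope.
Local Open Scope fset_scope.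
Local Open Scope ring_scope.

(* The monoid part is the library's multiplicative [monoidType], not assumed
   commutative; its product and unit live in [group_scope] (delimiter %g).
   The last three axioms say that F \ {0} is a group under the product. *)
HB.mixin Record Monoid_isScalarGroup F of Monoid F := {
  sg0 : F;
  sgN1 : F;
  sg_mul0l : forall a : F, (sg0 * a)%g = sg0;
  sg_mul0r : forall a : F, (a * sg0)%g = sg0;
  sg_sqr1 : forall x : F, (x * x)%g = 1%g <-> x = 1%g \/ x = sgN1;
  sg_one_neq0 : (1%g : F) <> sg0;
  sg_mul_neq0 : forall a b : F, a <> sg0 -> b <> sg0 -> (a * b)%g <> sg0;
  sg_inv : forall a : F, a <> sg0 ->
    exists b : F, [/\ b <> sg0, (a * b)%g = 1%g & (b * a)%g = 1%g]
}.

#[short(type="scalarGroupType")]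
HB.structure Definition ScalarGroup := {F of Monoid_isScalarGroup F & Monoid F}.

HB.mixin Record Zmodule_isFSpace (F : scalarGroupType) V of GRing.Zmodule V := {
  fscale : F -> V -> V;
  fscaleA : forall (a b : F) (v : V), fscale a (fscale b v) = fscale (a * b)%g v;
  fscale1 : forall v : V, fscale 1%g v = v;
  fscaleDr : forall (a : F) (v w : V), fscale a (v + w) = fscale a v + fscale a w;
  fscaleN1 : forall v : V, fscale sgN1 v = - v;
  fscale0 : forall v : V, fscale sg0 v = 0
}.

#[short(type="fspaceType")]
HB.structure Definition FSpace (F : scalarGroupType) :=
  {V of Zmodule_isFSpace F V & GRing.Zmodule V}.

Notation "a ** v" := (fscale a v) (at level 40, left associativity) : ring_scope.

Section NearVectorSpace.
Variables (F : scalarGroupType) (V : fspaceType F).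
Implicit Types (S B W : set V) (v : V).

Definition quasi_kernel : set V :=
  [set v | forall a b : F, exists c : F, a ** v + b ** v = c ** v].

Definition subgroup W : Prop :=
  [/\ W 0, forall x y, W x -> W y -> W (x + y) & forall x, W x -> W (- x)].

Definition free_action : Prop :=
  forall (a b : F) v, a ** v = b ** v -> v = 0 \/ a = b.

Definition near_vector_space : Prop :=
  free_action /\ smallest subgroup quasi_kernel = setT.

Definition subspace W : Prop :=
  [/\ W !=set0, forall x y, W x -> W y -> W (x + y)
    & forall (a : F) x, W x -> W (a ** x)].

Definition Span S : set V := smallest subspace S.

Definition generating S : Prop := Span S = setT.

Definition linearly_independent S : Prop :=
  ~ S 0 /\
  forall (A : {fset V}) (n : V -> nat) (alpha : V -> nat -> F),
    A != fset0 -> (forall a, a \in A -> S a) ->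
    \sum_(a <- A) \sum_(1 <= i < (n a).+1) alpha a i ** a = 0 ->
    forall a, a \in A -> \sum_(1 <= i < (n a).+1) alpha a i ** a = 0.

Definition scalar v : Prop :=
  Span [set v] = [set a ** v | a in [set: F]].

Definition basis B : Prop := linearly_independent B /\ generating B.

Definition scalar_basis B : Prop := basis B /\ forall v, B v -> scalar v.

End NearVectorSpace.

Arguments quasi_kernel {F} V.
Arguments near_vector_space {F} V.

(* Main.v *)
Require Import Defs.
From mathcomp Require Import all_boot all_order all_algebra finmap.
From mathcomp Require Import boolp classical_sets.

(** A maximal linearly independent [B] in [S] works. If [s] is in [S] but not
    in [B], a nontrivial relation on [B] and [s] has a nonzero term at [s]; as [s]
    is in the quasi-kernel that term is a single multiple [c ** s] with [c]
    nonzero, hence invertible, so [s] lies in the span of [B]. *)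

Local Open Scope classical_set_scope.

(** Induction on [r]: of the member of [C] that contains the tail and the one that contains the
    head, the larger contains both. For empty [r], any member of [C] will do. *)
Lemma seq_sub_chain (T : eqType) (C : set (set T)) (r : seq T) :
  total_on C subset -> C !=set0 ->
  (forall x, x \in r -> (\bigcup_(X in C) X) x) ->
  exists2 X, C X & forall x, x \in r -> X x.
Proof.
move=> totC C0; elim: r => [_|y r IHr Cr]; first by case: C0 => X CX; exists X.
have [|X CX Xr] := IHr; first by move=> x xr; apply: Cr; rewrite inE xr orbT.
have [Y CY Yy] := Cr y (mem_head y r).
have [XY|YX] := totC _ _ CX CY.
- by exists Y => // x; rewrite inE => /orP[/eqP->|/Xr/XY].
- by exists X => // x; rewrite inE => /orP[/eqP->|/Xr //]; apply: YX.
Qed.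

Section ScalarBasis.
Import GRing.Theory.
Local Open Scope ring_scope.
Variables (F : scalarGroupType) (V : fspaceType F).
Implicit Types (S B W : set V) (v : V).

Lemma subspace0 W : subspace W -> W 0.
Proof. by case=> -[w Ww] _ WZ; rewrite -(fscale0 w); apply: WZ. Qed.

Lemma subspaceN W v : subspace W -> W v -> W (- v).
Proof. by case=> _ _ WZ Wv; rewrite -fscaleN1; apply: WZ. Qed.

Lemma subspace_sum W (I : eqType) (r : seq I) (P : pred I) (x : I -> V) :
  subspace W -> (forall i, i \in r -> P i -> W (x i)) ->
  W (\sum_(i <- r | P i) x i).
Proof.
move=> sW Wx; rewrite big_seq_cond; elim/big_ind: _.
- exact: subspace0.
- by case: sW => _ + _; apply.
- by move=> i /andP[]; apply: Wx.
Qed.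

(** Closure under addition is exactly the quasi-kernel condition on [v]. *)
Lemma subspace_line v :
  quasi_kernel V v -> subspace [set a ** v | a in [set: F]].
Proof.
move=> Qv; split.
- by exists (1%g ** v), 1%g.
- move=> _ _ [a _ <-] [b _ <-].
  by have [c ->] := Qv a b; exists c.
- by move=> a _ [b _ <-]; exists (a * b)%g; rewrite // fscaleA.
Qed.

Lemma quasi_kernel_scalar v : quasi_kernel V v -> Defs.scalar v.
Proof.
move=> Qv; apply/seteqP; split.
- apply: smallest_sub; first exact: subspace_line.
  by move=> _ ->; exists 1%g; rewrite // fscale1.
- by move=> _ [a _ <-] W [[_ _ WZ] Wv]; apply/WZ/Wv.
Qed.

Lemma subspace_unscale W (a : F) v :
  subspace W -> W (a ** v) -> a ** v <> 0 -> W v.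
Proof.
move=> [_ _ WZ] Wav av0.
have [|b [_ _ ba]] := @sg_inv _ a; first by move=> a0; apply: av0; rewrite a0 fscale0.
by rewrite -(fscale1 v) -ba -fscaleA; apply: WZ.
Qed.

(** A relation involves only finitely many vectors, so it already lives in a single member of the
    chain. *)
Lemma linearly_independent_bigcup (C : set (set V)) :
  total_on C subset -> (forall X, C X -> linearly_independent X) ->
  linearly_independent (\bigcup_(X in C) X).
Proof.
move=> totC liC; split; first by move=> [X CX X0]; case: (liC _ CX).
move=> A n alpha A0 AC sum0 a aA.
(* The empty chain is allowed: its union is empty, so no [a] could come from it. *)
have C0 : C !=set0 by have [X CX _] := AC a aA; exists X.
have [X CX AX] := @seq_sub_chain V C (enum_fset A) totC C0 AC.
by have [_ /(_ A n alpha A0 AX sum0 a aA)] := liC X CX.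
Qed.

(** An arbitrary subspace [W] replaces the span of [B], so that the lemma applies to each member of
    the family whose intersection is that span. *)
Lemma linearly_independent_setU1 B s W :
  linearly_independent B -> quasi_kernel V s -> subspace W -> B `<=` W ->
  ~ W s -> linearly_independent (s |` B).
Proof.
move=> [B0 liB] Qs sW BW nWs; split.
  by move=> [s0|//]; apply: nWs; rewrite -s0; apply: subspace0.
move=> A n alpha A0 AB.
set x := fun a => \sum_(1 <= i < (n a).+1) alpha a i ** a.
rewrite -/(x _) => sum0 a aA.
have WZ : forall (c : F) y, W y -> W (c ** y) by case: sW.
have xs0 : s \in A -> x s = 0.
  move=> sA; apply: contrapT => xs0; apply: nWs.
  (* All summands of [x s] lie on the line through [s], which is a subspace, so they collapse to one
     multiple of [s]. *)
  have [c _ cs] : [set c ** s | c in [set: F]] (x s).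
    apply: subspace_sum; first exact: subspace_line.
    by move=> i _ _; exists (alpha s i).
  apply: (@subspace_unscale W c s) => //; last by rewrite cs.
  (* The relation makes [x s] the negative of a sum of terms at vectors of [B], all in [W]. *)
  rewrite cs; move: sum0; rewrite (big_fsetD1 s) //= => /eqP.
  rewrite addr_eq0 -/(x s) => /eqP ->; apply: subspaceN => //.
  apply: subspace_sum => // b; rewrite in_fsetD1 => /andP[bs bA] _.
  apply: subspace_sum => // i _ _; apply/WZ/BW.
  by case: (AB b bA) => // bs'; rewrite bs' eqxx in bs.
have [as_|as_] := eqVneq a s; first by rewrite as_ in aA *; apply: xs0.
have aA' : a \in (A `\ s)%fset by rewrite in_fsetD1 as_.
apply: (liB (A `\ s)%fset n alpha) => //.
- by apply/fset0Pn; exists a.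
- move=> b; rewrite in_fsetD1 => /andP[bs bA].
  by case: (AB b bA) => // bs'; rewrite bs' eqxx in bs.
(* Deleting [s] keeps the relation: its term vanishes if [s] is in [A], and otherwise [A] is
   unchanged. *)
- have [sA|sA] := boolP (s \in A).
    by move: sum0; rewrite (big_fsetD1 s) //= -/(x s) xs0 // add0r.
  by rewrite mem_fsetD1.
Qed.

End ScalarBasis.

Theorem lemma3p4 (F : scalarGroupType) (V : fspaceType F)
    (hV : near_vector_space V) (S : set V)
    (hSQ : S `<=` quasi_kernel V) (hS : generating S) :
  exists B : set V, B `<=` S /\ scalar_basis B.
Proof.
have [|B [[BS liB] maxB]] :=
    @Zorn_bigcup V [set B | B `<=` S /\ linearly_independent B].
  move=> C CP totC; split.
    by move=> v [X CX Xv]; have [XS _] := CP X CX; apply: XS.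
  by apply: linearly_independent_bigcup => // X /CP[].
exists B; split=> //; split; last by move=> v /BS/hSQ; apply: quasi_kernel_scalar.
split=> //; apply/seteqP; split=> // v _ W [sW BW].
suff SW : S `<=` W by have Sv : Span S v; [rewrite hS | exact: Sv].
move=> s Ss; apply: contrapT => nWs; apply: (maxB (s |` B)).
  split; first by move=> x; right.
  by move=> sBB; apply/nWs/BW/sBB; left.
split; first by move=> x [->|/BS].
exact: linearly_independent_setU1 (hSQ _ Ss) sW BW nWs.
Qed.
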